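(* Let $a\ge4$ be an even integer. The subtraction game $\mathcal{S}(1,a,3a-2)$ is ultimately periodic with period $3a-1$ and nim-sequence $(01)^{a/2-1}\,2\,(01)^{a/2}\,2\,(01)^{a/2-1}\,2$. Moreover, if $a=4$ then the subtraction set is non-expandable; otherwise the subtraction set has expansion $\{1,a,3a-2,3a\}\cup\{4a-1,6a-1\}^{*(3a-1)}$.
   Context: For a finite set $S$ of positive integers, the subtraction game $\mathcal{S}(S)$ is played on a single pile: two players alternately remove $s\in S$ coins (at most the pile size); the last mover wins. The nim-value is $\mathcal{G}(n)=\operatorname{mex}\{\mathcal{G}(n-s): s\in S, s\le n\}$. Words of single digits are written by juxtaposition, and $x^m$ denotes $m$-fold repetition of the block $x$. ''The game is ultimately periodic with period $p$ and nim-sequence $W$'' ($W$ a word of length $p$) means $p$ is the least positive integer with $\mathcal{G}(n+p)=\mathcal{G}(n)$ for all sufficiently large $n$, and there is $n_0\ge0$ such that $\mathcal{G}(n_0+j)$ is the $((j\bmod p)+1)$-st letter of $W$ for all $j\ge0$. The expansion of $S$ is $S^{ex}=\{s\ge1:\mathcal{G}(n+s)\ne\mathcal{G}(n)\ \forall n\ge0\}$; ''has expansion $T$'' means $S^{ex}=T$. For a set $X$ and $p\ge1$, $X^{*p}=\{x+mp:x\in X,m\ge0\}$. $S$ is non-expandable if $S^{ex}=S$ or $S^{ex}=S^{*p}$, $p$ the period. *)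

(* Defs.v *)
From mathcomp Require Import all_boot.
From mathcomp Require Import classical_sets.

Set Implicit Arguments.
Unset Strict Implicit.
Unset Printing Implicit Defensive.

Local Open Scope classical_set_scope.
Local Open Scope nat_scope.

(* By the pigeonhole principle, the search range 0, ..., size s contains a
   natural number that does not occur in s. *)
Definition mex (s : seq nat) : nat :=
  find [pred m | m \notin s] (iota 0 (size s).+1).

Lemma mex_has (s : seq nat) : has [pred m | m \notin s] (iota 0 (size s).+1).
Proof.
apply/negPn/negP => /hasPn sub.
have /(uniq_leq_size (iota_uniq 0 (size s).+1)) :
  {subset iota 0 (size s).+1 <= s}.
  by move=> m /sub /=; rewrite negbK.
by rewrite size_iota ltnn.
Qed.

Lemma mex_notin (s : seq nat) : mex s \notin s.
Proof.
have := nth_find 0 (mex_has s); rewrite nth_iota //=.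
by have := mex_has s; rewrite has_find size_iota.
Qed.

Lemma mex_min (s : seq nat) (m : nat) : m < mex s -> m \in s.
Proof.
move=> lt_m; have := before_find 0 lt_m.
rewrite nth_iota; first by move/negbFE.
by have := find_size [pred m | m \notin s] (iota 0 (size s).+1);
  rewrite size_iota; apply: leq_trans lt_m.
Qed.

(* A finite set of positive integers is given by a list, read up to
   membership. *)

(* [:: G 0; ...; G (n - 1)] *)
Fixpoint nim_prefix (S : seq nat) (n : nat) : seq nat :=
  if n is n'.+1 then
    let g := nim_prefix S n' in
    rcons g (mex [seq nth 0 g (n' - s) | s <- S & s <= n'])
  else [::].

Definition nim_value (S : seq nat) (n : nat) : nat :=
  nth 0 (nim_prefix S n.+1) n.

Lemma size_nim_prefix (S : seq nat) (n : nat) : size (nim_prefix S n) = n.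
Proof. by elim: n => //= n IHn; rewrite size_rcons IHn. Qed.

Lemma nth_nim_prefix (S : seq nat) (n k : nat) :
  k < n -> nth 0 (nim_prefix S n) k = nim_value S k.
Proof.
elim: n => // n IHn; rewrite ltnS leq_eqVlt => /orP[/eqP -> //|lt_kn].
by rewrite [LHS]/= nth_rcons size_nim_prefix lt_kn IHn.
Qed.

Lemma nim_valueE (S : seq nat) (n : nat) : all (leq 1) S ->
  nim_value S n = mex [seq nim_value S (n - s) | s <- S & s <= n].
Proof.
move=> /allP S_gt0.
rewrite {1}/nim_value /= nth_rcons size_nim_prefix ltnn eqxx.
congr mex; apply/eq_in_map => s; rewrite mem_filter => /andP[le_sn /S_gt0 s_gt0].
by rewrite nth_nim_prefix // ltn_subrL s_gt0 (leq_trans s_gt0).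
Qed.

Definition wpow (x : seq nat) (m : nat) : seq nat := flatten (nseq m x).

Definition eventual_period (f : nat -> nat) (p : nat) : Prop :=
  0 < p /\ exists N, forall n, N <= n -> f (n + p) = f n.

Definition least_period (f : nat -> nat) (p : nat) : Prop :=
  eventual_period f p /\ forall q, eventual_period f q -> p <= q.

Definition ultimately_periodic (S : seq nat) (p : nat) (W : seq nat) : Prop :=
  [/\ size W = p,
      least_period (nim_value S) p
    & exists n0, forall j, nim_value S (n0 + j) = nth 0 W (j %% p)].

Definition expansion (S : seq nat) : set nat :=
  [set s | 1 <= s /\ forall n, nim_value S (n + s) <> nim_value S n].

Definition star (X : set nat) (p : nat) : set nat :=
  [set y | exists2 x, X x & exists m, y = x + m * p].

Definition non_expandable (S : seq nat) : Prop :=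
  expansion S = [set` S] \/
  exists2 p, least_period (nim_value S) p & expansion S = star [set` S] p.

(* Main.v *)
(* Put p = 3a - 1. For a >= 6 the nim-values have a closed form: an explicit
   preperiod of length 3a + 1 followed by the repeated word, which is checked
   against the mex recursion; going back by 3a - 2 amounts to going forward by 1
   modulo p. The positions of the letter 2 in the word show that p is minimal.
   On the periodic part, the shifts that never meet equal values are those
   congruent to 1, a, -a or -1 modulo p. The preperiod excludes those congruent
   to -a, and those congruent to -1 other than 3a - 2, by a collision with
   position 0. For a = 4 the preperiod is different, but both the closed form and
   the expansion reduce to a finite computation by periodicity. *)
Require Import Defs.
From mathcomp Require Import all_boot.
From mathcomp Require Import classical_sets.
From mathcomp Require Import zify.

Local Open Scope classical_set_scope.
Local Open Scope nat_scope.

(** * Recognizing a nim-sequence from its mex property *)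

Lemma mex_eq (s : seq nat) (m : nat) :
  m \notin s -> (forall k, k < m -> k \in s) -> mex s = m.
Proof.
move=> m_notin lt_m_in; case: (ltngtP (mex s) m) => // [/lt_m_in|/mex_min].
  by rewrite (negbTE (mex_notin s)).
by rewrite (negbTE m_notin).
Qed.

Section NimValueCharacterization.

Variables (S : seq nat) (f : nat -> nat).
Hypothesis S_gt0 : all (leq 1) S.

Lemma nim_value_unique :
  (forall n s, s \in S -> f (n + s) <> f n) ->
  (forall n k, k < f n -> has [pred s | (s <= n) && (f (n - s) == k)] S) ->
  nim_value S =1 f.
Proof.
move=> f_neq f_mex n; elim/ltn_ind: n => n IHn.
have -> : nim_value S n = mex [seq f (n - s) | s <- S & s <= n].
  rewrite nim_valueE //; congr mex; apply/eq_in_map => s.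
  rewrite mem_filter => /andP[le_sn /(allP S_gt0) s_gt0].
  by apply: IHn; rewrite ltn_subrL s_gt0 (leq_trans s_gt0).
apply: mex_eq => [|k /f_mex /hasP[s sS /andP[le_sn /eqP <-]]].
  apply/mapP => -[s]; rewrite mem_filter => /andP[le_sn sS] fE.
  by apply: (f_neq (n - s) s sS); rewrite subnK.
by apply/mapP; exists s; rewrite ?mem_filter ?le_sn.
Qed.

Variables N p M : nat.
Hypothesis f_periodic : forall n, N <= n -> f (n + p) = f n.
Hypothesis p_gt0 : 0 < p.
Hypothesis S_leM : all (geq M) S.

(** Periodicity leaves finitely many positions to check. Inequalities descend by [p] once
    [n >= N + p]; for options, [n - s - p] must also stay at or above [N], hence the extra margin
    [M], a bound on the moves. *)
Lemma nim_value_periodic :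
  (forall n s, n < N + p -> s \in S -> f (n + s) <> f n) ->
  (forall n k, n < N + p + M -> k < f n ->
    has [pred s | (s <= n) && (f (n - s) == k)] S) ->
  nim_value S =1 f.
Proof.
move=> f_neq f_mex; apply: nim_value_unique => n.
  elim/ltn_ind: n => n IHn s sS.
  have [lt_n|le_n] := ltnP n (N + p); first exact: f_neq.
  rewrite -[n](@subnK p) 1?addnAC ?f_periodic; try lia.
  by apply: IHn => //; lia.
elim/ltn_ind: n => n IHn k.
have [/f_mex/[apply] //|le_n] := ltnP n (N + p + M).
rewrite -{1}(@subnK p n) ?f_periodic; try lia.
move=> /(IHn (n - p) ltac:(lia))/hasP[s sS /= /andP[le_s fE]].
apply/hasP; exists s => //=; have /= := allP S_leM s sS => le_sM.
have -> : n - s = n - p - s + p by lia.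
by rewrite f_periodic ?fE; lia.
Qed.

End NimValueCharacterization.

Lemma modn_lt_double (m d : nat) :
  m < 2 * d -> m %% d = if m < d then m else m - d.
Proof.
move=> lt_m; case: ltnP => [/modn_small //|le_dm].
by rewrite -[in LHS](subnK le_dm) modnDr modn_small //; lia.
Qed.

(** * The periodic word and the closed form *)

(* The letter at position [r] of the nim-sequence: outside the positions of the
   letter 2, letters are parities, counted from the start of the block. *)
Definition nim_letter (a r : nat) : nat :=
  if [|| r + 2 == a, r + 1 == 2 * a | r + 2 == 3 * a] then 2
  else if (a < r + 2) && (r + 1 < 2 * a) then ~~ odd r else odd r.

(** Gives the true values at 0, ..., 3a only for [a >= 6]. The value 3 occurs once, at 3a - 1. *)
Definition nim_preperiod (a n : nat) : nat :=
  if n + 1 == 3 * a then 3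
  else if [|| n == a, n == 2 * a + 1, n + 2 == 3 * a | n == 3 * a] then 2
  else if a < n <= 2 * a then ~~ odd n else odd n.

Definition nim_closed (a n : nat) : nat :=
  if n < 3 * a + 1 then nim_preperiod a n
  else nim_letter a ((n - (3 * a + 1)) %% (3 * a - 1)).

Ltac letter_cases :=
  rewrite /nim_preperiod /nim_letter;
  repeat (case: ifP => /= ?; try (exfalso; lia)).

Variant nim_letter_spec (a r : nat) : nat -> Type :=
  | NimLetterBlock1 of r + 2 < a : nim_letter_spec a r (odd r)
  | NimLetterTwo1 of r + 2 = a : nim_letter_spec a r 2
  | NimLetterBlock2 of a < r + 2 & r + 1 < 2 * a : nim_letter_spec a r (~~ odd r)
  | NimLetterTwo2 of r + 1 = 2 * a : nim_letter_spec a r 2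
  | NimLetterBlock3 of 2 * a <= r & r + 2 <> 3 * a : nim_letter_spec a r (odd r)
  | NimLetterTwo3 of r + 2 = 3 * a : nim_letter_spec a r 2.

Lemma nim_letterP (a r : nat) : nim_letter_spec a r (nim_letter a r).
Proof.
rewrite /nim_letter; case: eqP => [|n1] /=; first exact: NimLetterTwo1.
case: eqP => [|n2] /=; first exact: NimLetterTwo2.
case: eqP => [|n3] /=; first exact: NimLetterTwo3.
case: ifP => [/andP[]|/negbT mid]; first exact: NimLetterBlock2.
have [lt_r|ge_r] := ltnP (r + 2) a; first exact: NimLetterBlock1.
by apply: NimLetterBlock3 => //; lia.
Qed.

Lemma nth_wpow01 (m i : nat) : i < 2 * m -> nth 0 (wpow [:: 0; 1] m) i = odd i.
Proof.
elim: m i => [|m IHm] [|[|i]] //= lt_i.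
rewrite negbK -IHm //; lia.
Qed.

Lemma size_wpow01 (m : nat) : size (wpow [:: 0; 1] m) = 2 * m.
Proof. by elim: m => //= m; rewrite /wpow => ->; lia. Qed.

Definition nim_word (a : nat) : seq nat :=
  wpow [:: 0; 1] (a %/ 2 - 1) ++ [:: 2]
    ++ wpow [:: 0; 1] (a %/ 2) ++ [:: 2]
    ++ wpow [:: 0; 1] (a %/ 2 - 1) ++ [:: 2].

(** * Collisions and least period of the word *)

Section EvenParameter.

Variable a : nat.
Hypotheses (a_ge4 : 4 <= a) (a_even : ~~ odd a).

Local Notation p := (3 * a - 1).

Lemma size_nim_word : size (nim_word a) = p.
Proof. rewrite /nim_word !size_cat !size_wpow01 /=; lia. Qed.

Lemma nim_letter_eq2 (r : nat) :
  (nim_letter a r == 2) = [|| r + 2 == a, r + 1 == 2 * a | r + 2 == 3 * a].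
Proof. by rewrite /nim_letter; case: ifP => // _; case: ifP; case: odd. Qed.

Lemma nth_nim_word (r : nat) : r < p -> nth 0 (nim_word a) r = nim_letter a r.
Proof.
have [h def_a] : exists h, a = 2 * h by exists (a %/ 2); lia.
rewrite /nim_word /nim_letter => lt_r.
have -> : a %/ 2 = h by lia.
have nth2 i : i = 0 -> nth 0 [:: 2] i = 2 by move=> ->.
have nth01 m i : i < 2 * m -> nth 0 (wpow [:: 0; 1] m) i = odd i.
  exact: nth_wpow01.
rewrite !nth_cat !size_wpow01 /= -!subnDA.
case: ifP => [lt1|/negbT ge1].
  by rewrite nth01 //; case: ifP => [|_]; [|case: ifP => //]; lia.
case: ifP => [lt2|/negbT ge2]; first by rewrite nth2; [case: ifP|]; lia.
case: ifP => [lt3|/negbT ge3].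
  rewrite nth01; last lia.
  case: ifP => [|_]; [lia|case: ifP => [_|]; [|lia]].
  by congr nat_of_bool; lia.
case: ifP => [lt4|/negbT ge4]; first by rewrite nth2; [case: ifP|]; lia.
case: ifP => [lt5|/negbT ge5].
  rewrite nth01; last lia.
  case: ifP => [|_]; [lia|case: ifP => [|_]; [lia|]].
  by congr nat_of_bool; lia.
by rewrite nth2; [case: ifP|]; lia.
Qed.

Lemma nim_letter_block1 (r : nat) : r + 2 < a -> nim_letter a r = odd r.
Proof. by move=> lt_r; letter_cases. Qed.

Lemma nim_letter_block2 (r : nat) :
  a < r + 2 -> r + 1 < 2 * a -> nim_letter a r = ~~ odd r.
Proof. by move=> gt_r lt_r; letter_cases. Qed.

Lemma nim_letter_block3 (r : nat) :
  2 * a <= r -> r + 2 < 3 * a -> nim_letter a r = odd r.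
Proof. by move=> ge_r lt_r; letter_cases. Qed.

(** The four excluded shifts are 1, a, -a and -1 modulo [p]. For any other shift, parity yields two
    equal letters inside the 01 blocks. *)
Lemma nim_letter_collision (t : nat) :
  t < p -> t \notin [:: 1; a; 2 * a - 1; 3 * a - 2] ->
  exists2 r, r < p & nim_letter a ((r + t) %% p) = nim_letter a r.
Proof.
move=> lt_t; rewrite !inE !negb_or => /and4P[n1 n2 n3 n4].
(* Here [v] is [r + t] reduced modulo [p], with at most one wrap-around. *)
have collide r v : r < p -> v = r + t \/ v + p = r + t -> v < p ->
    nim_letter a v = nim_letter a r ->
    exists2 r, r < p & nim_letter a ((r + t) %% p) = nim_letter a r.
  move=> lt_r def_v lt_v rv; exists r => //.
  by case: def_v => <-; rewrite ?modnDr modn_small.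
(* The 01 blocks now occupy 0..2g-1, 2g+1..4g+2 and 4g+4..6g+3. The excluded shifts 1, 2g+2, 4g+3
   and 6g+4 separate the odd and the even [t] into three ranges each. *)
have [g def_a] : exists g, a = 2 * g + 2 by exists (a %/ 2 - 1); lia.
have [|[|[|[|[|]]]]] :
    (exists2 k, t = 2 * k + 1 & 1 <= k <= g) \/
    (exists2 k, t = 2 * k + 1 & g + 1 <= k <= 2 * g) \/
    (exists2 j, t = 2 * j + (4 * g + 5) & j < g) \/
    (exists2 k, t = 2 * k & k <= g) \/
    (exists2 j, t = 2 * j + (4 * g + 6) & j + 2 <= g) \/
    (exists2 j, t = 2 * j + (2 * g + 4) & j <= g).
- case: (boolP (odd t)) => odd_t.
    have [k def_t] : exists k, t = 2 * k + 1 by exists (t %/ 2); lia.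
    have [le1|gt1] := leqP k g; first by left; exists k; lia.
    have [le2|gt2] := leqP k (2 * g); first by right; left; exists k; lia.
    by right; right; left; exists (k - (2 * g + 2)); lia.
  have [k def_t] : exists k, t = 2 * k by exists (t %/ 2); lia.
  do 3 right; have [le1|gt1] := leqP k g; first by left; exists k; lia.
  have [le2|gt2] := leqP k (2 * g + 2).
    by right; right; exists (k - (g + 2)); lia.
  by right; left; exists (k - (2 * g + 3)); lia.
all: move=> [k def_t le_k]; clear n1 n2 n3 n4.
(* The pairs lie, in order, in blocks 2 and 3, 1 and 2, 2 and 2, 2 and 2, 3 and 2, 3 and 2; the last
   three odd or even ranges wrap around exactly when [t > 4g + 4] or [r] ends block 3. *)
- apply: (collide (4 * g + 2) (4 * g + 3 + 2 * k)); try lia.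
  rewrite nim_letter_block3 1?nim_letter_block2; lia.
- apply: (collide 0 (2 * k + 1)); try lia.
  rewrite nim_letter_block2 1?nim_letter_block1; lia.
- apply: (collide (4 * g + 1) (2 * k + (2 * g + 1))); try lia.
  rewrite !nim_letter_block2; lia.
- apply: (collide (2 * g + 1) (2 * k + (2 * g + 1))); try lia.
  rewrite !nim_letter_block2; lia.
- have [u def_u] : exists u, u + k = 3 * g by exists (3 * g - k); lia.
  apply: (collide (2 * u + 1) (4 * g + 2)); try lia.
  rewrite nim_letter_block2 1?nim_letter_block3; lia.
- apply: (collide (6 * g + 3) (2 * k + (2 * g + 2))); try lia.
  rewrite nim_letter_block2 1?nim_letter_block3; lia.
Qed.

Section EventuallyNimWord.

Variables (f : nat -> nat) (N : nat).
Hypothesis fE : forall j, f (N + j) = nim_letter a (j %% p).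

Lemma nim_word_periodic (n k : nat) : N <= n -> f (n + k * p) = f n.
Proof.
by move=> le_n; rewrite -(subnKC le_n) -addnA !fE addnC modnMDl.
Qed.

Lemma nim_word_least_period : least_period f p.
Proof.
split.
  split; first lia.
  by exists N => n /(nim_word_periodic _ 1); rewrite mul1n.
move=> q [q_gt0 [K f_q]]; rewrite leqNgt; apply/negP => lt_q.
(* Cyclically, the gap [a + 1] between two letters 2 occurs only once. *)
have f1 := f_q (N + (K * p + (a - 2))) ltac:(nia).
have f2 := f_q (N + (K * p + (2 * a - 1))) ltac:(nia).
move: f1 f2; rewrite -!addnA !fE !modnMDl.
rewrite [(a - 2) %% p]modn_small ?[(2 * a - 1) %% p]modn_small; try lia.
rewrite ![(_ + q) %% p]modn_lt_double; try lia.
have -> : nim_letter a (a - 2) = 2 by apply/eqP; rewrite nim_letter_eq2; lia.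
have -> : nim_letter a (2 * a - 1) = 2.
  by apply/eqP; rewrite nim_letter_eq2; lia.
by move=> /eqP + /eqP; rewrite !nim_letter_eq2; case: ifP; case: ifP; lia.
Qed.

End EventuallyNimWord.
End EvenParameter.

(** * The closed form for [a >= 6]: mex recursion and avoided shifts *)

Section LargeParameter.

Variable a : nat.
Hypotheses (a_ge6 : 6 <= a) (a_even : ~~ odd a).

Local Notation p := (3 * a - 1).
Local Notation N := (3 * a + 1).

Lemma nim_closed_tail (j : nat) : nim_closed a (N + j) = nim_letter a (j %% p).
Proof. by rewrite /nim_closed ltnNge leq_addr addKn. Qed.

Lemma nim_closed_periodic (n k : nat) :
  N <= n -> nim_closed a (n + k * p) = nim_closed a n.
Proof. exact: (nim_word_periodic _ _ _ nim_closed_tail). Qed.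

(** Every 1 follows a 0 and every 2 closes a block ending in 1. Thus removing one coin supplies the
    option just below a nonzero value. *)
Lemma nim_letter_succ (r : nat) : nim_letter a ((r + 1) %% p) <> 0 ->
  nim_letter a ((r + 1) %% p) = (nim_letter a (r %% p)).+1.
Proof.
rewrite -modnDml; have : r %% p < p by rewrite ltn_pmod //; lia.
move: (r %% p) => {}r lt_r.
have [lt_r1|ge_r1] := ltnP (r + 1) p; first by rewrite modn_small //; letter_cases; lia.
have -> : r + 1 = p by lia.
by rewrite modnn; letter_cases; lia.
Qed.

(** Each 2 is followed by the initial 0 of the next block, cyclically. This supplies the option 0
    through the move 3a - 2, which is -1 modulo [p]. *)
Lemma nim_letter_gt1 (r : nat) :
  1 < nim_letter a (r %% p) -> nim_letter a ((r + 1) %% p) = 0.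
Proof.
rewrite -modnDml; have : r %% p < p by rewrite ltn_pmod //; lia.
move: (r %% p) => {}r lt_r.
have [lt_r1|ge_r1] := ltnP (r + 1) p; first by rewrite modn_small //; letter_cases; lia.
have -> : r + 1 = p by lia.
by rewrite modnn; letter_cases; lia.
Qed.

Lemma nim_letter_neq_succ (r : nat) :
  nim_letter a ((r + 1) %% p) <> nim_letter a (r %% p).
Proof.
have [next0|/eqP/nim_letter_succ->] := eqVneq (nim_letter a ((r + 1) %% p)) 0;
  last lia.
move: next0; rewrite -modnDml; have : r %% p < p by rewrite ltn_pmod //; lia.
move: (r %% p) => {}r lt_r; have [lt_r1|ge_r1] := ltnP (r + 1) p.
  by rewrite modn_small //; case: nim_letterP; case: nim_letterP; lia.
have -> : r + 1 = p by lia.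
by rewrite modnn; case: (nim_letterP a r); lia.
Qed.

Lemma nim_letter_neq (r s : nat) : s \in [:: 1; a; 3 * a - 2] ->
  nim_letter a ((r + s) %% p) <> nim_letter a (r %% p).
Proof.
rewrite !inE => /or3P[]/eqP->; first exact: nim_letter_neq_succ.
  rewrite -modnDml; have : r %% p < p by rewrite ltn_pmod //; lia.
  move: (r %% p) => {}r lt_r.
  have [lt_ra|] := ltnP (r + a) p.
    by rewrite modn_small //; case: nim_letterP; case: nim_letterP; lia.
  move/subnK; move: (r + a - p) => u def_ra.
  rewrite -def_ra modnDr modn_small; last lia.
  have {}def_ra : u + 2 * a = r + 1 by lia.
  by case: nim_letterP; case: nim_letterP; lia.
(* A shift by 3a - 2 followed by a shift by 1 is a full period. *)
have := nim_letter_neq_succ (r + (3 * a - 2)).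
have -> : r + (3 * a - 2) + 1 = r + p by lia.
by rewrite modnDr => neq /esym.
Qed.

Lemma nim_closed_head (n : nat) : n < N -> nim_closed a n = nim_preperiod a n.
Proof. by rewrite /nim_closed => ->. Qed.

Lemma nim_closed_mid (n r : nat) :
  n = N + r -> r < p -> nim_closed a n = nim_letter a r.
Proof. by move=> -> lt_r; rewrite nim_closed_tail modn_small. Qed.

Lemma nim_closed_neq (n s : nat) : s \in [:: 1; a; 3 * a - 2] ->
  nim_closed a (n + s) <> nim_closed a n.
Proof.
have [lt_n|/subnKC <-] := ltnP n N; last first.
  by rewrite -addnA !nim_closed_tail; exact: nim_letter_neq.
rewrite !inE (nim_closed_head n) // => s_in.
have [lt_ns|/subnKC] := ltnP (n + s) N.
  rewrite nim_closed_head //.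
  by case/or3P: s_in lt_ns => /eqP-> lt_ns; letter_cases; lia.
(* The pair straddles the end of the preperiod; as [s <= 3 * a - 2], the upper position is in the
   first period. *)
move: (n + s - N) => r def_r; rewrite (nim_closed_mid _ r) //; last first.
  by case/or3P: s_in def_r => /eqP->; lia.
by case/or3P: s_in def_r => /eqP-> def_r; letter_cases; lia.
Qed.

(** Since 3a = 1 + p, the periodic part inherits this from the move 1; the preperiod is checked
    directly. *)
Lemma nim_closed_neq_3a (n : nat) : nim_closed a (n + 3 * a) <> nim_closed a n.
Proof.
have [lt_n|le_n] := ltnP n N; last first.
  have -> : n + 3 * a = n + 1 + 1 * p by lia.
  rewrite nim_closed_periodic; [exact: nim_closed_neq|lia].
rewrite (nim_closed_head n) //; case: (posnP n) => [->|n_gt0].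
  by rewrite nim_closed_head; [letter_cases; lia|lia].
(* Only from n = 3a does the shift leave the first period. *)
have [def_n|n_neq] := eqVneq n (3 * a).
  have -> : n + 3 * a = N + 0 + 1 * p by lia.
  by rewrite nim_closed_periodic ?(nim_closed_mid _ 0); [letter_cases| | |]; lia.
by rewrite (nim_closed_mid _ (n - 1)); [letter_cases| |]; lia.
Qed.

Lemma nim_closed_neq_6a1 (n k : nat) :
  nim_closed a (n + (6 * a - 1 + k * p)) <> nim_closed a n.
Proof.
rewrite addnA nim_closed_periodic; try lia.
(* As 6a - 1 = 3a + p, the shift 3a decides all [n > 0]; for n = 0 the position 3a is still in the
   preperiod, so [p] cannot be subtracted. *)
case: (posnP n) => [->|n_gt0].
  rewrite (nim_closed_mid _ (3 * a - 2)); try lia.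
  by rewrite nim_closed_head; [letter_cases|]; lia.
have -> : n + (6 * a - 1) = n + 3 * a + 1 * p by lia.
by rewrite nim_closed_periodic; [exact: nim_closed_neq_3a|lia].
Qed.

Lemma nim_closed_neq_4a1 (n k : nat) :
  nim_closed a (n + (4 * a - 1 + k * p)) <> nim_closed a n.
Proof.
rewrite addnA nim_closed_periodic; try lia.
have [lt_n|le_n] := ltnP n N; last first.
  have -> : n + (4 * a - 1) = n + a + 1 * p by lia.
  by rewrite nim_closed_periodic; [apply: nim_closed_neq; rewrite !inE eqxx orbT|lia].
rewrite (nim_closed_head n) //.
(* The target [N + (n + a - 2)] is in the first period exactly in the first case. *)
have [lt_na|le_na] := ltnP (n + a) (3 * a + 1).
  have [u def_u] : exists u, u + 2 = n + a by exists (n + a - 2); lia.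
  by rewrite (nim_closed_mid _ u); [letter_cases| |]; lia.
have [u def_u] : exists u, u + N = n + a by exists (n + a - N); lia.
have -> : n + (4 * a - 1) = N + u + 1 * p by lia.
rewrite nim_closed_periodic ?(nim_closed_mid _ u); try lia.
by letter_cases; lia.
Qed.

(** The exception is position 3a, whose value 2 comes after the value 3. *)
Lemma nim_closed_succ (n : nat) : n + 1 <> 3 * a -> nim_closed a (n + 1) <> 0 ->
  nim_closed a (n + 1) = (nim_closed a n).+1.
Proof.
move=> n_neq; have [lt_n|/subnKC <-] := ltnP n N; last first.
  by rewrite -addnA !nim_closed_tail; exact: nim_letter_succ.
have [lt_n1|le_n1] := ltnP (n + 1) N.
  by rewrite !nim_closed_head //; letter_cases; lia.
by rewrite (nim_closed_mid _ 0); [letter_cases| |]; lia.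
Qed.

(** The exception is position 3a - 1, of value 3, from which the move 3a - 2 reaches position 1, of
    value 1. *)
Lemma nim_closed_gt1 (n : nat) : n <> 1 ->
  1 < nim_closed a (n + (3 * a - 2)) -> nim_closed a n = 0.
Proof.
move=> n_neq; have [lt_n|/subnKC <-] := ltnP n N; last first.
  rewrite -addnA !nim_closed_tail => /nim_letter_gt1.
  have -> : n - N + (3 * a - 2) + 1 = n - N + p by lia.
  by rewrite modnDr.
rewrite (nim_closed_head n) //; have [lt_n3|le_n3] := ltnP n 3.
  by rewrite nim_closed_head; [letter_cases|]; lia.
have [u def_u] : exists u, u + 3 = n by exists (n - 3); lia.
by rewrite (nim_closed_mid _ u); [letter_cases| |]; lia.
Qed.

Lemma nim_closed_le3 (n : nat) :
  nim_closed a n <= 2 + (n + 1 == 3 * a).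
Proof.
rewrite /nim_closed; case: ifP => [lt_n|ge_n]; first by letter_cases; lia.
by move: (_ %% _) => r; letter_cases; lia.
Qed.

(** The move 1 supplies the largest required option. Apart from positions 3a and 3a - 1, treated by
    hand, only the option 0 of a value 2 remains: the move 3a - 2 gives it when available, and the
    move a at the two earlier positions a and 2a + 1. *)
Lemma nim_closed_mex (n k : nat) : k < nim_closed a n ->
  has [pred s | (s <= n) && (nim_closed a (n - s) == k)] [:: 1; a; 3 * a - 2].
Proof.
move=> lt_k; have wit m s : s \in [:: 1; a; 3 * a - 2] -> n = m + s ->
    nim_closed a m = k ->
  has [pred s | (s <= n) && (nim_closed a (n - s) == k)] [:: 1; a; 3 * a - 2].
  by move=> sS -> mE; apply/hasP; exists s; rewrite //= leq_addl addnK mE eqxx.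
have aS : a \in [:: 1; a; 3 * a - 2] by rewrite !inE eqxx orbT.
have bS : 3 * a - 2 \in [:: 1; a; 3 * a - 2] by rewrite !inE eqxx !orbT.
have le3 := nim_closed_le3 n.
have [n0|n_gt0] := posnP n.
  by move: lt_k; rewrite n0 nim_closed_head; [letter_cases|]; lia.
have [def_n|n_neq] := eqVneq n (3 * a).
  case: k lt_k wit => [|[|k]] lt_k wit; last lia.
    by apply: (wit 2 _ bS); rewrite ?nim_closed_head; try letter_cases; lia.
  by apply: (wit (2 * a) _ aS); rewrite ?nim_closed_head; try letter_cases; lia.
have nE : n - 1 + 1 = n by lia.
have succE : nim_closed a n = (nim_closed a (n - 1)).+1.
  have := nim_closed_succ (n - 1); rewrite nE; apply; lia.
have [def_k|k_neq] := eqVneq k.+1 (nim_closed a n).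
  by apply: (wit (n - 1) 1); rewrite ?inE //; lia.
have [def_n1|n_neq1] := eqVneq (n + 1) (3 * a).
  case: k lt_k wit k_neq => [|[|k]] lt_k wit k_neq; last lia.
    by apply: (wit (2 * a - 1) _ aS); rewrite ?nim_closed_head; try letter_cases; lia.
  by apply: (wit 1 _ bS); rewrite ?nim_closed_head; try letter_cases; lia.
have k0 : k = 0 by lia.
have fn : nim_closed a n = 2 by lia.
have [lt_n|le_n] := ltnP n (3 * a - 2).
  have : n = a \/ n = 2 * a + 1.
    by move: fn; rewrite nim_closed_head; [letter_cases|]; lia.
  move=> [] def_n; [apply: (wit 0 _ aS)|apply: (wit (a + 1) _ aS)];
  by rewrite ?nim_closed_head; try letter_cases; lia.
have bE := subnK le_n; apply: (wit _ _ bS (esym bE)); rewrite k0.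
by apply: nim_closed_gt1; rewrite ?bE ?fn; lia.
Qed.

End LargeParameter.

(** * Nim-values and expansion for [a >= 6] *)

Lemma nim_value_large (a : nat) : 6 <= a -> ~~ odd a ->
  nim_value [:: 1; a; 3 * a - 2] =1 nim_closed a.
Proof.
move=> a_ge6 a_even; apply: nim_value_unique.
- by rewrite /=; lia.
- exact: nim_closed_neq.
- exact: nim_closed_mex.
Qed.

Lemma expansion_eq (S : seq nat) (f : nat -> nat) : nim_value S =1 f ->
  expansion S = [set s | 1 <= s /\ forall n, f (n + s) <> f n].
Proof.
by move=> SE; apply/seteqP; split=> s [s_gt0 sP]; split=> // n;
  have := sP n; rewrite !SE.
Qed.

Lemma expansion_large (a : nat) : 6 <= a -> ~~ odd a ->
  expansion [:: 1; a; 3 * a - 2] = [set 1; a; 3 * a - 2; 3 * a]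
    `|` star [set 4 * a - 1; 6 * a - 1] (3 * a - 1).
Proof.
move=> a_ge6 a_even; rewrite (expansion_eq _ _ (nim_value_large _ a_ge6 a_even)).
have memS s : s \in [:: 1; a; 3 * a - 2] ->
  forall n, nim_closed a (n + s) <> nim_closed a n.
  by move=> sS n; apply: nim_closed_neq.
apply/seteqP; split=> s /=; last first.
  case=> [[[[->|->]|->]|->]|[x [->|->] [m ->]]]; (split; first by [lia | apply: ltn_addr; lia]).
  - by apply: memS.
  - by apply: memS; rewrite !inE eqxx orbT.
  - by apply: memS; rewrite !inE eqxx !orbT.
  - by move=> n; apply: nim_closed_neq_3a.
  - by move=> n; apply: nim_closed_neq_4a1.
  - by move=> n; apply: nim_closed_neq_6a1.
set p := 3 * a - 1; move=> [s_gt0 s_exp].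
have p_gt0 : 0 < p by rewrite /p; lia.
have := divn_eq s p; have := ltn_pmod s p_gt0.
move: (s %/ p) (s %% p) => k t lt_t def_s.
(* Collisions in the periodic part confine the residue of [s]. *)
have t_in : t \in [:: 1; a; 2 * a - 1; 3 * a - 2].
  apply/negPn/negP => /(nim_letter_collision a ltac:(lia) a_even _ lt_t)[r lt_r].
  move=> rE; apply: (s_exp (3 * a + 1 + r)).
  by rewrite -addnA !nim_closed_tail def_s addnCA modnMDl (modn_small lt_r).
have f0 : nim_closed a 0 = 0 by rewrite nim_closed_head; [letter_cases|]; lia.
(* A shift that sends position 0, of value 0, to a letter 0 is impossible. *)
have even_tail u j : s = 3 * a + 1 + u + j * p -> u < p -> nim_letter a u <> 0.
  move=> def_s' lt_u u0; apply: (s_exp 0).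
  rewrite add0n def_s' nim_closed_periodic; last lia.
  by rewrite (nim_closed_mid _ (3 * a + 1 + u) u) // u0 f0.
have pE : p + 1 = 3 * a by rewrite /p; lia.
clearbody p.
move: t_in; rewrite !inE => /or4P[]/eqP def_t; rewrite {t}def_t in lt_t def_s.
(* Residue 1 gives 1, then 1 + p = 3a, then 1 + 2p = 6a - 1 and its translates; residue a gives a,
   then a + p = 4a - 1 and its translates. *)
- case: k def_s => [|[|k]]; rewrite ?mulSn => def_s.
  + by left; left; left; left; lia.
  + by left; right; lia.
  + by right; exists (6 * a - 1); [right|exists k; lia].
- case: k def_s => [|k]; rewrite ?mulSn => def_s.
  + by left; left; left; right; lia.
  + by right; exists (4 * a - 1); [left|exists k; lia].
(* Residue -a: position 2a - 1 has value 0, and later shifts land on letter 2a - 3, which is 0. *)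
- case: k def_s => [|k]; rewrite ?mulSn => def_s.
    case: (s_exp 0); rewrite f0 nim_closed_head; last lia.
    by rewrite def_s; letter_cases; lia.
  have := even_tail (2 * a - 3) k; move=> /(_ ltac:(lia) ltac:(lia)).
  by case; letter_cases; lia.
(* Residue -1: beyond 3a - 2 itself, shifts land on letter 3a - 4, which is 0. *)
- case: k def_s => [|k]; rewrite ?mulSn => def_s.
    by left; left; right; lia.
  have := even_tail (3 * a - 4) k; move=> /(_ ltac:(lia) ltac:(lia)).
  by case; letter_cases; lia.
Qed.

(** * The case a = 4, by finite computation *)

(** Periodicity already starts at 16; the table stops at 24 so that the tail begins with the first
    letter of the word. *)
Definition nim_prefix4 : seq nat :=
  [:: 0; 1; 0; 1; 2; 0; 1; 0; 1; 2; 3; 2; 3; 0; 1; 3; 0; 1; 0; 1; 2; 0; 1; 2].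

Definition nim_closed4 (n : nat) : nat :=
  if n < 24 then nth 0 nim_prefix4 n else nim_letter 4 ((n - 24) %% 11).

Lemma nim_closed4_tail (j : nat) :
  nim_closed4 (24 + j) = nim_letter 4 (j %% (3 * 4 - 1)).
Proof. by rewrite /nim_closed4 ltnNge leq_addr addKn. Qed.

Lemma nim_value4 : nim_value [:: 1; 4; 10] =1 nim_closed4.
Proof.
apply: (@nim_value_periodic _ _ _ 24 11 10) => //.
- by move=> n /(nim_word_periodic _ _ _ nim_closed4_tail _ 1); rewrite mul1n.
- have /allP h : all (fun n => all (fun s => nim_closed4 (n + s) != nim_closed4 n)
    [:: 1; 4; 10]) (iota 0 35) by vm_compute.
  move=> n s lt_n; have /h/allP : n \in iota 0 35 by rewrite mem_iota.
  by move=> /[apply] /eqP.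
- have /allP h : all (fun n => all (fun k =>
    has [pred s | (s <= n) && (nim_closed4 (n - s) == k)] [:: 1; 4; 10])
    (iota 0 (nim_closed4 n))) (iota 0 45) by vm_compute.
  move=> n k lt_n lt_k; have /h/allP : n \in iota 0 45 by rewrite mem_iota.
  by apply; rewrite mem_iota.
Qed.

Lemma expansion4 : expansion [:: 1; 4; 10] = [set` [:: 1; 4; 10]].
Proof.
rewrite (expansion_eq _ _ nim_value4); apply/seteqP; split=> s /=; last first.
  move=> sS; split; first by move: sS; rewrite !inE => /or3P[]/eqP->.
  (* A move makes the value at [n] an option of [n + s], and mex avoids it. *)
  move=> n; rewrite -!nim_value4 (nim_valueE (n + s)) // => mexE.
  have := mex_notin [seq nim_value [:: 1; 4; 10] (n + s - i)
                    | i <- [:: 1; 4; 10] & i <= n + s].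
  rewrite mexE => /mapP[]; exists s; first by rewrite mem_filter leq_addl.
  by rewrite addnK.
move=> [s_gt0 s_exp]; apply: contraT => s_notin.
have /allP h : all (fun s => (s \in [:: 0; 1; 4; 10]) ||
    has (fun n => nim_closed4 (n + s) == nim_closed4 n) (iota 0 35)) (iota 0 35).
  by vm_compute.
have [lt_s|le_s] := ltnP s 35.
  have /h/orP[] : s \in iota 0 35 by rewrite mem_iota.
    by rewrite inE (negbTE s_notin) orbF eqn0Ngt s_gt0.
  by move=> /hasP[n _ /eqP /s_exp].
(* The representative of [s] modulo 11 in 24..34: since [s0 >= 24], every [n + s0] is in the
   periodic part, so a collision for [s0] is one for [s]. *)
pose s0 := 24 + (s - 24) %% 11.
have lt_mod : (s - 24) %% 11 < 11 by rewrite ltn_pmod.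
have /h/orP[] : s0 \in iota 0 35 by rewrite mem_iota /s0; lia.
  by rewrite /s0 !inE; lia.
move=> /hasP[n _ /eqP n_coll]; case: (s_exp n); rewrite -n_coll.
have -> : n + s = n + s0 + (s - 24) %/ 11 * 11.
  by rewrite /s0; have := divn_eq (s - 24) 11; lia.
by rewrite (nim_word_periodic _ _ _ nim_closed4_tail) // /s0; lia.
Qed.

(** * Conclusion for both cases *)

Lemma ultimately_periodic_nim_word (a : nat) (S : seq nat) (f : nat -> nat) (N : nat) :
  4 <= a -> ~~ odd a -> nim_value S =1 f ->
  (forall j, f (N + j) = nim_letter a (j %% (3 * a - 1))) ->
  ultimately_periodic S (3 * a - 1) (nim_word a).
Proof.
move=> a_ge4 a_even SE fE.
have tail j : nim_value S (N + j) = nim_letter a (j %% (3 * a - 1)).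
  by rewrite SE.
split; first exact: size_nim_word.
  exact: (nim_word_least_period _ a_ge4 a_even _ _ tail).
by exists N => j; rewrite tail nth_nim_word // ltn_pmod //; lia.
Qed.

Theorem theorem3p8 (a : nat) (a_ge4 : 4 <= a) (a_even : ~~ odd a) :
  let S := [:: 1; a; 3 * a - 2] in
  [/\ ultimately_periodic S (3 * a - 1)
        (wpow [:: 0; 1] (a %/ 2 - 1) ++ [:: 2]
           ++ wpow [:: 0; 1] (a %/ 2) ++ [:: 2]
           ++ wpow [:: 0; 1] (a %/ 2 - 1) ++ [:: 2]),
      a = 4 -> non_expandable S
    & a <> 4 ->
      expansion S = [set 1; a; 3 * a - 2; 3 * a]
                      `|` star [set 4 * a - 1; 6 * a - 1] (3 * a - 1)].
Proof.
move=> S; have a_ge6 : a <> 4 -> 6 <= a by lia.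
split.
- have [a4|/eqP /a_ge6 {}a_ge6] := eqVneq a 4.
    apply: (ultimately_periodic_nim_word _ _ nim_closed4 24); rewrite // /S a4.
      exact: nim_value4.
    exact: nim_closed4_tail.
  apply: (ultimately_periodic_nim_word _ _ (nim_closed a) (3 * a + 1)) => //.
    exact: nim_value_large.
  exact: nim_closed_tail.
- by move=> a4; left; rewrite /S a4; exact: expansion4.
- by move=> /a_ge6 {}a_ge6; exact: expansion_large.
Qed.
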